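(* Let $n\geq 5$. Then $M_{4,n}$ is the unique maximal $K_{1,4}$-matroid on $K_n$ (in the weak order), and its rank function is $\mathrm{val}_{K_{1,4}}$.
   Context: For $F\subseteq E(K_n)$, $K_n[F]$ is the graph with edge set $F$ and vertex set the vertices incident to $F$. $K_b+\bar K_{n-b}$ is the join of the complete graph $K_b$ and the edgeless graph $\bar K_{n-b}$. A set is cyclic in a matroid if it is a union of circuits; a cyclic flat is a flat that is cyclic. A matroid is determined by its cyclic flats and their ranks. Definition of $M_{t,n}$ for integers $t\geq 3$, $n\geq t+1$: let $\tau=\lfloor(2t+1)/3\rfloor$ and $f(b)=(t-1)b-\binom{b}{2}$. $M_{t,n}$ is the matroid on $E=E(K_n)$ whose cyclic flats are $\emptyset$, $E$, and all $F\subseteq E$ with $K_n[F]\cong K_b+\bar K_{n-b}$ for some $1\leq b\leq\tau-1$, with ranks $r(\emptyset)=0$, $r(E)=f(\tau)$ and $r(F)=f(b)$ if $K_n[F]\cong K_b+\bar K_{n-b}$ (such a matroid exists). For $t=4$: $\tau=3$, $f(b)=3b-\binom b2$. A $K_{1,t}$-matroid on $K_n$ is a matroid on $E(K_n)$ in which the edge set of every copy of $K_{1,t}$ is a circuit. Weak order: $M\preceq N$ if every independent set of $M$ is independent in $N$. For a family ${\cal X}$ of subsets of $E$, a proper ${\cal X}$-sequence is a (possibly empty) finite sequence ${\cal S}=(X_1,\dots,X_k)$ of members of ${\cal X}$ with $X_i\not\subseteq\bigcup_{j<i}X_j$ for $i=2,\dots,k$. For $F\subseteq E$, $\mathrm{val}(F,{\cal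 S})=|F\cup\bigcup_{i=1}^kX_i|-k$ and $\mathrm{val}_{\cal X}(F)=\min_{\cal S}\mathrm{val}(F,{\cal S})$ over all proper ${\cal X}$-sequences ${\cal S}$. $\mathrm{val}_{K_{1,t}}$ denotes $\mathrm{val}_{\cal X}$ with ${\cal X}$ the family of edge sets of all copies of $K_{1,t}$ in $K_n$. *)

(* Defs.v *)
From mathcomp Require Import all_boot all_order all_algebra.

Set Implicit Arguments.
Unset Strict Implicit.
Unset Printing Implicit Defensive.

Import Order.TTheory GRing.Theory Num.Theory.

Section Matroids.
Variable T : finType.
Implicit Types (A B C F I X : {set T}).

Definition matroid_axioms (J : {set {set T}}) : bool :=
  [&& set0 \in J,
      [forall A in J, forall B : {set T}, (B \subset A) ==> (B \in J)]
    & [forall A in J, forall B in J,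
         (#|A| < #|B|) ==> [exists x in B :\: A, x |: A \in J]]].

(* The axioms are boolean, so that two matroids with the same independent sets
   are Leibniz-equal. *)
Record matroid := Matroid {
  indep : {set {set T}};
  matroidP : matroid_axioms indep }.

Implicit Types M N : matroid.

Definition circuit M C : bool := minset (fun A => A \notin indep M) C.

Definition rank M X : nat := \max_(I in indep M | I \subset X) #|I|.

Definition flat M F : Prop :=
  forall x, x \notin F -> rank M F < rank M (x |: F).

Definition cyclic M F : Prop :=
  exists2 P : {set {set T}}, {in P, forall C, circuit M C} & F = cover P.

Definition cyclic_flat M F : Prop := flat M F /\ cyclic M F.

Definition weak_le M N : Prop := indep M \subset indep N.

Definition maximal_in (P : matroid -> Prop) M : Prop :=
  P M /\ forall N, P N -> weak_le M N -> N = M.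

Definition unique_maximal_in (P : matroid -> Prop) M : Prop :=
  forall N, maximal_in P N <-> N = M.

Definition union_seq (S : seq {set T}) : {set T} := \bigcup_(X <- S) X.

(* Indices start at 0, so the condition on X_2, ..., X_k is about the positive
   indices; the first member is unconstrained. *)
Definition proper_seq (XX : {set {set T}}) (S : seq {set T}) : Prop :=
  {subset S <= XX} /\
  forall i, 0 < i < size S -> ~~ (nth set0 S i \subset union_seq (take i S)).

(* Valued in int: the difference need not be natural for arbitrary families. *)
Definition val_seq F (S : seq {set T}) : int :=
  (#|F :|: union_seq S|%:Z - (size S)%:Z)%R.

Definition is_val (XX : {set {set T}}) F (v : int) : Prop :=
  (exists2 S, proper_seq XX S & val_seq F S = v) /\
  (forall S, proper_seq XX S -> (v <= val_seq F S)%R).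

End Matroids.

Section Graphs.

(* Injectivity together with equality of cardinals says that f is bijective;
   this keeps the predicate boolean. *)
Definition graph_iso (T1 T2 : finType) (e1 : rel T1) (e2 : rel T2) : bool :=
  [exists f : {ffun T1 -> T2},
     [&& injectiveb f, #|T1| == #|T2|
       & [forall x, forall y, e2 (f x) (f y) == e1 x y]]].

Definition complete_graph (b : nat) : rel 'I_b := [rel x y | x != y].

Definition edgeless_graph (b : nat) : rel 'I_b := [rel x y | false].

Definition join_graph (T1 T2 : finType) (e1 : rel T1) (e2 : rel T2) :
    rel (T1 + T2)%type :=
  fun u v => match u, v with
    | inl x, inl y => e1 x y
    | inr x, inr y => e2 x y
    | _, _ => true
    end.

End Graphs.

Definition edge (n : nat) : finType := {e : {set 'I_n} | #|e| == 2}.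

Section CompleteGraph.
Variable n : nat.
Implicit Types F : {set edge n}.

Definition incident_vertices F : {set 'I_n} :=
  [set v | [exists e in F, v \in val e]].

(* The vertex type of K_n[F] consists of the vertices incident to F only. *)
Definition edge_subgraph F : rel {v : 'I_n | v \in incident_vertices F} :=
  [rel u v | [exists e in F, val e == [set val u; val v]]].

Definition is_K_join F (b : nat) : bool :=
  graph_iso (@edge_subgraph F)
    (join_graph (@complete_graph b) (@edgeless_graph (n - b))).

(* K_{1,t} has no isolated vertex, so a copy of it in K_n is K_n[F] for its
   edge set F. *)
Definition star_copies (t : nat) : {set {set edge n}} :=
  [set F : {set edge n} | graph_iso (@edge_subgraph F)
             (join_graph (@edgeless_graph 1) (@edgeless_graph t))].

Definition K1t_matroid (t : nat) (M : matroid (edge n)) : Prop :=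
  {in star_copies t, forall F, circuit M F}.

Definition tau (t : nat) : nat := (2 * t + 1) %/ 3.

Definition rank_value (t b : nat) : int :=
  ((t%:Z - 1) * b%:Z - 'C(b, 2)%:Z)%R.

(* A matroid is determined by its cyclic flats and their ranks, so at most one
   M satisfies this. *)
Definition is_M (t : nat) (M : matroid (edge n)) : Prop :=
  [/\ forall F, cyclic_flat M F <->
        [\/ F = set0, F = setT
          | exists2 b, 1 <= b <= (tau t).-1 & is_K_join F b],
      rank M set0 = 0,
      (rank M setT)%:Z%R = rank_value t (tau t)
    & forall F b, 1 <= b <= (tau t).-1 -> is_K_join F b ->
        (rank M F)%:Z%R = rank_value t b].

End CompleteGraph.

(* Main.v *)
Require Import Defs.
From mathcomp Require Import all_boot all_order all_algebra zify.

(* Every matroid satisfies: X is independent iff #|X :&: Z| <= r(Z) for all cyclic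
   flats Z, because the closure of a circuit is a cyclic flat. So M_{4,n} can only
   be the matroid whose independent sets have at most 6 edges, at most 3 at each
   vertex and at most 5 meeting each pair of vertices. For any K_{1,4}-matroid N
   and proper sequence S of stars, each member of S that is not covered by the
   previous ones raises the nullity by at least one, so r_N(F) <= val(F, S).
   Conversely, adding the edges of a cyclic flat Z one at a time, each completing
   a K_{1,4}, to a set of r(Z) edges gives S inside Z with #|Z| - #|S| <= r(Z).
   This bounds r_N on each cyclic flat, hence N is below M_{4,n}, and it makes
   val(F, S) at most r(Z) + #|F :\: Z|, whose minimum over Z is the rank of F. *)

Set Implicit Arguments.
Unset Strict Implicit.
Unset Printing Implicit Defensive.

(** * Finite sets and equality of matroids *)

Lemma exists_subset_card (T : finType) (A : {set T}) k :
  k <= #|A| -> exists2 B : {set T}, B \subset A & #|B| = k.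
Proof.
case/card_geqP => s [us ss sub]; exists [set x in s].
  by apply/subsetP => x; rewrite inE => /sub.
by rewrite cardsE (card_uniqP us).
Qed.

Lemma card_setU_setD (T : finType) (A B : {set T}) : #|A :|: B| = #|A| + #|B :\: A|.
Proof. by rewrite -(cardsID A) setUK setDUl setDv set0U. Qed.

Lemma matroid_eq (T : finType) (M N : matroid T) : indep M = indep N -> M = N.
Proof.
case: M N => [I PI] [J PJ] /= eqIJ; case: J / eqIJ PJ => PJ.
by rewrite (bool_irrelevance PI PJ).
Qed.

(** * Independent sets, bases and rank *)

Section MatroidTheory.
Variables (T : finType) (M : matroid T).
Implicit Types (A B C F I X Y Z : {set T}) (S : seq {set T}).

Lemma indep0 : set0 \in indep M.
Proof. by case/and3P: (matroidP M). Qed.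

Lemma indepS A B : B \subset A -> A \in indep M -> B \in indep M.
Proof.
move=> sBA AM; case/and3P: (matroidP M) => _ /forall_inP/(_ A AM) + _.
by move/forallP/(_ B)/implyP; apply.
Qed.

Lemma indep_augment A B :
  A \in indep M -> B \in indep M -> #|A| < #|B| ->
  exists2 x, x \in B :\: A & x |: A \in indep M.
Proof.
move=> AM BM ltAB; case/and3P: (matroidP M) => _ _ /forall_inP/(_ A AM).
by move/forall_inP/(_ B BM)/implyP/(_ ltAB)/exists_inP.
Qed.

Lemma indep_le_rank I X : I \in indep M -> I \subset X -> #|I| <= rank M X.
Proof.
move=> IM sIX; rewrite /rank.
by apply: (@leq_bigmax_cond _ _ (fun I : {set T} => #|I|)); rewrite IM.
Qed.

Lemma rankP X (r : nat) :
  reflect (forall I, I \in indep M -> I \subset X -> #|I| <= r) (rank M X <= r).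
Proof.
apply: (iffP (bigmax_leqP _ _ _)) => [H I IM sIX|H I /andP[]]; last exact: H.
by apply: H; rewrite IM.
Qed.

(** An inclusion-maximal independent set between [I] and [X] has maximum cardinality: a larger
    independent subset of [X] would augment it. *)
Lemma extend_to_basis I X :
  I \in indep M -> I \subset X ->
  exists2 B, B \in indep M & [/\ I \subset B, B \subset X & #|B| = rank M X].
Proof.
move=> IM sIX; pose P := [pred B : {set T} | (B \in indep M) && (B \subset X)].
have PI : P I by rewrite /= IM.
case: (maxset_exists PI) => B /maxsetP[/andP[BM sBX] maxB] sIB.
exists B => //; split=> //; apply/eqP; rewrite eqn_leq indep_le_rank //=.
apply/rankP => K KM sKX; rewrite leqNgt; apply/negP => ltBK.
have [x] := indep_augment BM KM ltBK; rewrite inE => /andP[xB xK] xBM.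
have /setP/(_ x) : x |: B = B.
  apply: maxB; last exact: subsetUr.
  by rewrite /= xBM subUset sBX sub1set (subsetP sKX).
by rewrite setU11 (negPf xB).
Qed.

Lemma basis_exists X :
  exists2 B, B \in indep M & B \subset X /\ #|B| = rank M X.
Proof.
have [B BM [_ sBX cB]] := extend_to_basis indep0 (sub0set X).
by exists B.
Qed.

Lemma rankS X Y : X \subset Y -> rank M X <= rank M Y.
Proof.
move=> sXY; apply/rankP => I IM sIX.
by apply: indep_le_rank => //; apply: subset_trans sXY.
Qed.

Lemma indep_rank X : (X \in indep M) = (#|X| <= rank M X).
Proof.
apply/idP/idP => [XM|le]; first exact: indep_le_rank.
have [B BM [sBX cB]] := basis_exists X.
by have /eqP <- : B == X by rewrite eqEcard sBX cB.
Qed.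

Lemma rank0 : rank M set0 = 0.
Proof.
apply/eqP; rewrite -leqn0; apply/rankP => I _; rewrite subset0 => /eqP->.
by rewrite cards0.
Qed.

Lemma rank_le_setD X Y : rank M X <= rank M Y + #|X :\: Y|.
Proof.
apply/rankP => I IM sIX; rewrite -(cardsID Y I) leq_add ?subset_leq_card ?setSD //.
by apply: indep_le_rank (subsetIr _ _); apply: indepS IM; apply: subsetIl.
Qed.

(** * Circuits *)

Lemma circuitP C :
  reflect (C \notin indep M /\ forall e, e \in C -> C :\ e \in indep M)
          (circuit M C).
Proof.
apply: (iffP minsetP) => [[CM minC]|[CM minC]].
  split=> // e eC; apply: contraLR eC => /minC/(_ (subD1set _ _)) <-.
  by rewrite setD11.
split=> // A AM sAC; apply/eqP; rewrite eqEsubset sAC /=.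
apply: contraR AM => /subsetPn[e eC eA]; apply: indepS (minC e eC).
by rewrite subsetD1 sAC.
Qed.

Lemma dependent_circuit X :
  X \notin indep M -> exists2 C, circuit M C & C \subset X.
Proof.
move=> XM; have [C cC sCX] := @minset_exists _ [pred A | A \notin indep M] _ XM.
by exists C.
Qed.

Lemma circuit_neq0 C : circuit M C -> C != set0.
Proof. by case/circuitP=> CM _; apply: contraNneq CM => ->; apply: indep0. Qed.

(** The independent set [C :\ e] extends to a basis of [X], and this basis avoids [e], since
    otherwise it would contain [C]. *)
Lemma rank_setD1_circuit C X e :
  circuit M C -> C \subset X -> e \in C -> rank M (X :\ e) = rank M X.
Proof.
case/circuitP=> CM minC sCX eC; apply/eqP; rewrite eqn_leq rankS ?subD1set //=.
have sCX' : C :\ e \subset X by apply: subset_trans sCX; apply: subD1set.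
have [B BM [sCB sBX <-]] := extend_to_basis (minC e eC) sCX'.
apply: indep_le_rank => //; rewrite subsetD1 sBX /=.
apply: contra CM => eB; apply: indepS BM.
by rewrite -(setD1K eC) subUset sub1set eB.
Qed.

(** * Closure and cyclic flats *)

Definition closure X := [set x | rank M (x |: X) == rank M X].

Lemma sub_closure X : X \subset closure X.
Proof. by apply/subsetP => x xX; rewrite inE (setUidPr _) ?sub1set. Qed.

(** A larger independent set in the closure would augment a basis of [X] by an element that, being
    in the closure, cannot raise the rank. *)
Lemma rank_closure X : rank M (closure X) = rank M X.
Proof.
apply/eqP; rewrite eqn_leq (rankS (sub_closure X)) andbT.
have [B BM [sBX cB]] := basis_exists X.
apply/rankP => I IM sIX; rewrite leqNgt -cB; apply/negP => ltBI.
have [x /setDP[xI xB] xBM] := indep_augment BM IM ltBI.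
have := subsetP sIX x xI; rewrite inE => /eqP rx.
have := indep_le_rank xBM (setUS _ sBX).
by rewrite cardsU1 xB rx -cB ltnn.
Qed.

Lemma closure_flat X : flat M (closure X).
Proof.
move=> x; rewrite inE => nx; rewrite rank_closure.
have: rank M (x |: X) <= rank M (x |: closure X).
  by apply: rankS; apply: setUS; apply: sub_closure.
apply: leq_trans; rewrite ltn_neqAle eq_sym nx.
by apply: rankS; apply: subsetUr.
Qed.

(** A point of the closure outside [C] closes a circuit with a basis of [C]; that circuit stays in
    the closure and must pass through the point. *)
Lemma closure_circuit_cyclic C : circuit M C -> cyclic M (closure C).
Proof.
move=> cC; exists [set D | circuit M D & D \subset closure C].
  by move=> D; rewrite inE => /andP[].
apply/eqP; rewrite eqEsubset; apply/andP; split; last first.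
  by apply/bigcupsP => D; rewrite inE => /andP[].
apply/subsetP => x xC; have [x_C|nxC] := boolP (x \in C).
  by apply/bigcupP; exists C; rewrite ?inE ?cC ?sub_closure.
have [B BM [sBC cB]] := basis_exists C.
have [|D cD sD] := @dependent_circuit (x |: B).
  apply/negP => xBM; have := indep_le_rank xBM (setUS _ sBC).
  move: xC; rewrite inE => /eqP->; rewrite cardsU1 -cB.
  by rewrite (contra (subsetP sBC x) nxC) ltnn.
apply/bigcupP; exists D.
  rewrite inE cD (subset_trans sD) // subUset sub1set xC.
  by apply: subset_trans sBC (sub_closure C).
apply: contraTT cD => nxD; apply/circuitP => -[/negP[]].
apply: indepS BM; apply/subsetP => y yD; have /setU1P[yx|//] := subsetP sD y yD.
by rewrite -yx yD in nxD.
Qed.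

Lemma indep_cyclic_flatP X :
  X \in indep M <-> (forall Z, cyclic_flat M Z -> #|X :&: Z| <= rank M Z).
Proof.
split=> [XM Z _|H].
  by apply: indep_le_rank (subsetIr _ _); apply: indepS XM; apply: subsetIl.
apply: contraT => XM; have [C cC sCX] := dependent_circuit XM.
have cfC : cyclic_flat M (closure C).
  by split; [apply: closure_flat|apply: closure_circuit_cyclic].
have := H _ cfC; rewrite rank_closure => le.
case/circuitP: cC => /negP[]; rewrite indep_rank; apply: leq_trans le.
by apply: subset_leq_card; rewrite subsetI sCX sub_closure.
Qed.

(** Recognises a cyclic flat from a set [Z] attaining the rank bound. An element of [F] outside [Z]
    lies on a circuit in [F], so deleting it keeps the rank of [F] but lowers the bound. Hence [F]
    lies in [Z], the ranks agree, and flatness of [F] gives equality. *)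
Lemma cyclic_flat_eq F Z :
  cyclic_flat M F -> rank M Z + #|F :\: Z| <= rank M F -> F = Z.
Proof.
move=> [flF [P cP eF]] le.
have sFZ : F \subset Z.
  apply/subsetP => x xF; apply: contraLR le => nxZ; rewrite -ltnNge.
  move: (xF); rewrite {1}eF => /bigcupP[C CP xC].
  have sCF : C \subset F by rewrite eF; apply: bigcup_sup.
  rewrite -(rank_setD1_circuit (cP C CP) sCF xC).
  apply: leq_ltn_trans (rank_le_setD (F :\ x) Z) _; rewrite ltn_add2l.
  rewrite (cardsD1 x (F :\: Z)) !inE nxZ xF add1n ltnS.
  by apply: subset_leq_card; apply/subsetP => y; rewrite !inE => /and3P[-> -> ->].
apply/eqP; rewrite eqEsubset sFZ /=; apply/subsetP => x xZ.
apply: contraT => /flF; rewrite ltnNge => /negP[].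
apply: leq_trans (leq_trans (leq_addr _ _) le).
by apply: rankS; rewrite subUset sub1set xZ.
Qed.

Lemma cyclic_coverP F :
  cyclic M F <->
  (forall x, x \in F -> exists C, [/\ circuit M C, C \subset F & x \in C]).
Proof.
split=> [[P cP ->] x /bigcupP[C CP xC]|H].
  by exists C; split=> //; [apply: cP|apply: bigcup_sup].
exists [set D | circuit M D & D \subset F].
  by move=> D; rewrite inE => /andP[].
apply/eqP; rewrite eqEsubset; apply/andP; split; last first.
  by apply/bigcupsP => D; rewrite inE => /andP[].
apply/subsetP => x /H[C [cC sCF xC]]; apply/bigcupP; exists C => //.
by rewrite inE cC.
Qed.

(** * Proper sequences of circuits and the rank *)

Lemma union_seq_rcons S X : union_seq (rcons S X) = union_seq S :|: X.
Proof. by rewrite /union_seq big_rcons /= setUC. Qed.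

Lemma proper_seq_nil (XX : {set {set T}}) : proper_seq XX [::].
Proof. by split=> // -[]. Qed.

Lemma take_rcons_le S X i : i <= size S -> take i (rcons S X) = take i S.
Proof. by move=> le; rewrite -cats1 takel_cat. Qed.

(** Lets proper sequences be built and analysed from their end. The guard [0 < size S] leaves the
    first member unconstrained. *)
Lemma proper_seq_rcons (XX : {set {set T}}) S X :
  proper_seq XX (rcons S X) <->
  [/\ proper_seq XX S, X \in XX & 0 < size S -> ~~ (X \subset union_seq S)].
Proof.
split=> [[sub prop]|[[sub prop] XXX nX]].
  split; first 1 last.
  - by apply: sub; rewrite mem_rcons mem_head.
  - by move=> S0; have := prop (size S); rewrite size_rcons S0 ltnSn nth_rcons ltnn
      eqxx take_rcons_le // take_size; apply.
  split=> [Y YS|i /andP[i0 iS]]; first by apply: sub; rewrite mem_rcons inE YS orbT.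
  have := prop i; rewrite size_rcons i0 ltnS (ltnW iS) nth_rcons iS.
  by rewrite take_rcons_le ?(ltnW iS) //; apply.
split=> [Y|i]; first by rewrite mem_rcons inE => /predU1P[->//|/sub].
rewrite size_rcons => /andP[i0]; rewrite ltnS leq_eqVlt => /predU1P[eiS|iS].
  by rewrite eiS nth_rcons ltnn eqxx take_rcons_le // take_size nX // -eiS.
by rewrite nth_rcons iS take_rcons_le ?(ltnW iS) // prop ?i0.
Qed.

(** Let [U] be the union so far. Deleting from [U :|: X] an element of the circuit [X] outside [U]
    keeps the rank, so [X] raises the rank by at most [#|X :\: U| - 1]. *)
Lemma rank_add_size_le (XX : {set {set T}}) S :
  {in XX, forall X, circuit M X} -> proper_seq XX S ->
  rank M (union_seq S) + size S <= #|union_seq S|.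
Proof.
move=> circ; elim/last_ind: S => [_|S X IH].
  by rewrite /union_seq big_nil rank0 cards0.
case/proper_seq_rcons => /IH {}IH /circ cX nX.
(* For the first member the union is empty, and the new element exists because circuits are
   nonempty. *)
have /subsetPn[e eX eU] : ~~ (X \subset union_seq S).
  case: S nX {IH} => [_|Y S]; last exact.
  by rewrite /union_seq big_nil subset0; apply: circuit_neq0.
rewrite union_seq_rcons size_rcons; set U := union_seq S in IH eU *.
rewrite -(rank_setD1_circuit cX (subsetUr _ _) eX).
have := rank_le_setD ((U :|: X) :\ e) U.
have -> : (U :|: X) :\ e :\: U = (X :\: U) :\ e.
  by apply/setP => y; rewrite !inE; case: (y == e); case: (y \in U).
rewrite card_setU_setD.
have : e \in X :\: U by rewrite inE eU.
by move=> eXU; rewrite (cardsD1 e (X :\: U)) eXU; lia.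
Qed.

Lemma rank_le_val (XX : {set {set T}}) F S :
  {in XX, forall X, circuit M X} -> proper_seq XX S ->
  (Posz (rank M F) <= val_seq F S)%R.
Proof.
move=> circ propS; have := rank_add_size_le circ propS.
have := rank_le_setD F (union_seq S).
rewrite /val_seq setUC card_setU_setD; lia.
Qed.

End MatroidTheory.

(** * Stars and joins as edge sets in the complete graph *)

Section Stars.
Variable n : nat.
Implicit Types (e : edge n) (u v w x y : 'I_n) (W V N : {set 'I_n}).
Implicit Types (A F U X : {set edge n}).

Definition star v : {set edge n} := [set e : edge n | v \in val e].

(** The star with centre [v] and leaf set [N]. If [v] is in [N] it contributes no edge, because
    [[set v; v]] has one element. *)
Definition fan v N : {set edge n} :=
  [set e : edge n | [exists w in N, val e == [set v; w]]].

Lemma edge_ofP v e : v \in val e -> exists2 w, w != v & val e = [set v; w].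
Proof.
case/cards2P: (valP e) => x [y [nxy ->]]; rewrite !inE => /orP[]/eqP->.
  by exists y; rewrite // eq_sym.
by exists x; rewrite // setUC.
Qed.

Lemma edge_exists u v : u != v -> exists e : edge n, val e = [set u; v].
Proof.
move=> nuv; have c2 : #|[set u; v]| == 2 by rewrite cards2 nuv.
by exists (exist (fun s : {set 'I_n} => #|s| == 2) _ c2).
Qed.

Lemma set2_injr v : injective (fun w => [set v; w]).
Proof.
move=> x y /= eqxy; have := set22 v x; rewrite eqxy !inE => /orP[]/eqP // xv.
by have := set22 v y; rewrite -eqxy xv !inE orbb => /eqP->.
Qed.

(** Both sides are counted through their injective images among the vertex pairs. *)
Lemma card_fan v N : v \notin N -> #|fan v N| = #|N|.
Proof.
move=> nvN; rewrite -(card_imset _ (@set2_injr v)) -(card_imset _ val_inj).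
congr #|pred_of_set _|; apply/setP => s; apply/imsetP/imsetP => [[e]|[w wN ->]].
  by rewrite inE => /exists_inP[w wN /eqP ew] ->; exists w.
have [|e ee] := @edge_exists v w; first by apply: contraNneq nvN => ->.
by exists e; rewrite // inE; apply/exists_inP; exists w; rewrite // ee.
Qed.

Lemma fan_sub_star v N : fan v N \subset star v.
Proof.
by apply/subsetP => e; rewrite !inE => /exists_inP[w _ /eqP->]; rewrite set21.
Qed.

Lemma star_fan v : star v = fan v [set~ v].
Proof.
apply/eqP; rewrite eqEsubset fan_sub_star andbT; apply/subsetP => e.
rewrite !inE => /edge_ofP[w nwv ew]; apply/exists_inP.
by exists w; rewrite ?ew // !inE.
Qed.

Lemma card_star v : #|star v| = n.-1.
Proof. by rewrite star_fan card_fan ?inE ?eqxx // cardsC1 card_ord. Qed.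

Lemma star_cap_val u v e : u != v -> e \in star u :&: star v -> val e = [set u; v].
Proof.
move=> nuv; rewrite !inE => /andP[ue ve]; apply/esym/eqP.
by rewrite eqEcard subUset !sub1set ue ve cards2 nuv (eqP (valP e)).
Qed.

Lemma card_star_cap u v : u != v -> #|star u :&: star v| = 1.
Proof.
move=> nuv; have [e ee] := edge_exists nuv.
suff -> : star u :&: star v = [set e] by rewrite cards1.
apply/setP => d; rewrite in_set1; apply/idP/eqP => [/(star_cap_val nuv) de|->].
  by apply: val_inj; rewrite /= de ee.
by rewrite !inE ee set21 set22.
Qed.

(** For disjoint [W] and [V], the edge set of the join of the complete graph on [W] and the edgeless
    graph on [V]. *)
Definition join_edges W V : {set edge n} :=
  [set e : edge n | ~~ [disjoint val e & W] && (val e \subset W :|: V)].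

Lemma eq_graph_iso (T1 T2 : finType) (e1 : rel T1) (e2 e2' : rel T2) :
  e2 =2 e2' -> graph_iso e1 e2 = graph_iso e1 e2'.
Proof.
move=> eqe; apply: eq_existsb => f; do 2!congr (_ && _).
by apply: eq_forallb => x; apply: eq_forallb => y; rewrite eqe.
Qed.

Lemma edge_subgraphE F (a b : {v | v \in incident_vertices F}) e :
  val e = [set val a; val b] -> edge_subgraph a b = (e \in F).
Proof.
move=> ee; apply/exists_inP/idP => [[d dF /eqP de]|eF].
  by rewrite (val_inj (etrans ee (esym de))).
by exists e; rewrite // ee.
Qed.

Lemma edge_subgraph_neq F (a b : {v | v \in incident_vertices F}) :
  edge_subgraph a b -> val a != val b.
Proof.
case/exists_inP=> e _ /eqP ee; apply/eqP => eqab.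
by have := valP e; rewrite /= ee eqab setUid cards1.
Qed.

Lemma join_edgesE W V x y e : val e = [set x; y] -> x \in W :|: V -> y \in W :|: V ->
  (e \in join_edges W V) = (x \in W) || (y \in W).
Proof.
move=> ee xWV yWV; rewrite inE ee subUset !sub1set xWV yWV !andbT.
by rewrite -setI_eq0 setIUl setU_eq0 negb_and !setI_eq0 !disjoints1 !negbK.
Qed.

(** Each vertex has a neighbour in the opposite part, as both parts are nonempty and completely
    joined. *)
Lemma incident_join_edges b m W V :
  #|W| = b.+1 -> #|V| = m.+1 -> [disjoint W & V] ->
  incident_vertices (join_edges W V) = W :|: V.
Proof.
move=> cW cV dWV; apply/setP => v; rewrite inE; apply/exists_inP/idP => [[e]|vWV].
  by rewrite inE => /andP[_ /subsetP sub] /sub.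
have [w [wWV nwv wW]] : exists w, [/\ w \in W :|: V, v != w & (v \in W) || (w \in W)].
  case/setUP: vWV => vW.
    have /card_gt0P[w wV] : 0 < #|V| by rewrite cV.
    exists w; rewrite inE wV orbT vW; split=> //.
    by apply: contraTneq wV => <-; rewrite (disjointFr dWV).
  have /card_gt0P[w wW] : 0 < #|W| by rewrite cW.
  exists w; rewrite inE wW orbT; split=> //.
  by apply: contraTneq wW => <-; rewrite (disjointFl dWV).
have [e ee] := edge_exists nwv.
by exists e; rewrite ?ee ?set21 // (join_edgesE ee).
Qed.

(** Turns the abstract isomorphism into two concrete vertex sets, so that later arguments deal with
    edge sets only. *)
Lemma graph_iso_joinP b m F :
  reflect (exists W V, [/\ #|W| = b.+1, #|V| = m.+1, [disjoint W & V]
                         & F = join_edges W V])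
    (graph_iso (@edge_subgraph n F)
       (join_graph (@complete_graph b.+1) (@edgeless_graph m.+1))).
Proof.
apply: (iffP existsP) => [[f /and3P[/injectiveP injf /eqP cf fE]]|].
  have {}fE (x y : {v | v \in incident_vertices F}) :
      join_graph (@complete_graph b.+1) (@edgeless_graph m.+1) (f x) (f y)
      = edge_subgraph x y.
    by apply/eqP; move/forallP/(_ x)/forallP/(_ y): fE.
  have bijf : bijective f by apply: inj_card_bij; rewrite ?cf.
  (* [W] and [V] are the preimages of the two summands of the vertex type of the join. *)
  pose W := val @: (f @^-1: [set inl i | i : 'I_b.+1]).
  pose V := val @: (f @^-1: [set inr i | i : 'I_m.+1]).
  have memW (x : {v | v \in incident_vertices F}) :
      (val x \in W) = if f x is inl _ then true else false.
    rewrite mem_imset; last exact: val_inj.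
    rewrite inE; case: (f x) => i; first by rewrite imset_f.
    by apply/imsetP => -[].
  have memV (x : {v | v \in incident_vertices F}) :
      (val x \in V) = if f x is inr _ then true else false.
    rewrite mem_imset; last exact: val_inj.
    rewrite inE; case: (f x) => i; last by rewrite imset_f.
    by apply/imsetP => -[].
  exists W, V; split.
  - rewrite card_imset; last exact: val_inj.
    rewrite on_card_preimset; last exact: onW_bij.
    by rewrite card_imset ?card_ord // => i j [].
  - rewrite card_imset; last exact: val_inj.
    rewrite on_card_preimset; last exact: onW_bij.
    by rewrite card_imset ?card_ord // => i j [].
  - rewrite disjoint_subset; apply/subsetP => v /imsetP[x xW ->].
    have := imset_f val xW; rewrite -/W memW inE memV.
    by case: (f x).
  have memWV v (vF : v \in incident_vertices F) : v \in W :|: V.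
    have := memV (exist _ v vF); have := memW (exist _ v vF).
    by rewrite inE /=; case: (f _) => _ -> ->.
  have sWV v : v \in W :|: V -> v \in incident_vertices F.
    by case/setUP => /imsetP[x _ ->]; apply: valP.
  have memF x y e : x \in incident_vertices F -> y \in incident_vertices F ->
      x != y -> val e = [set x; y] -> (e \in F) = (x \in W) || (y \in W).
    move=> xF yF nxy ee.
    pose a : {v | v \in incident_vertices F} := exist _ x xF.
    pose c : {v | v \in incident_vertices F} := exist _ y yF.
    rewrite -(@edge_subgraphE F a c e ee) -fE (memW a) (memW c).
    have : f a != f c by rewrite (inj_eq injf) -val_eqE.
    by case: (f a) (f c) => i [] j.
  apply/setP => e; have /cards2P[x [y [nxy ee]]] := valP e.
  apply/idP/idP => [eF|eJ].
    have xF : x \in incident_vertices F.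
      by rewrite inE; apply/exists_inP; exists e; rewrite //= ee set21.
    have yF : y \in incident_vertices F.
      by rewrite inE; apply/exists_inP; exists e; rewrite //= ee set22.
    by rewrite (join_edgesE ee) ?memWV // -(memF x y e).
  have [xWV yWV] : x \in W :|: V /\ y \in W :|: V.
    by move: eJ; rewrite inE => /andP[_ /subsetP s]; split; apply: s;
      rewrite /= ee !inE eqxx ?orbT.
  by rewrite (memF x y e) ?sWV // -(join_edgesE ee xWV yWV).
move=> [W [V [cW cV dWV eF]]].
have incF : incident_vertices F = W :|: V by rewrite eF (incident_join_edges cW cV).
(* Each part is numbered by its enumeration. The default value of [inord] never occurs, since an
   index in [enum W] or [enum V] is below the cardinality. *)
pose f (a : {v | v \in incident_vertices F}) : 'I_b.+1 + 'I_m.+1 :=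
  if val a \in W then inl (inord (index (val a) (enum W)))
  else inr (inord (index (val a) (enum V))).
have memWV (a : {v | v \in incident_vertices F}) : val a \in W :|: V.
  by rewrite -incF; apply: valP.
have memV (a : {v | v \in incident_vertices F}) : val a \notin W -> val a \in V.
  by have := memWV a; rewrite inE; case: (_ \in W).
have injf : injective f.
  move=> a c; rewrite /f; case: (boolP (val a \in W)) => aW.
    case: (boolP (val c \in W)) => // cW' [] /(congr1 val).
    rewrite /= !inordK; last first.
    - by rewrite -cW cardE index_mem mem_enum.
    - by rewrite -cW cardE index_mem mem_enum.
    by move/(index_inj (val a)) => eq; apply: val_inj; apply: eq; rewrite mem_enum.
  case: (boolP (val c \in W)) => // cW' [] /(congr1 val).
  rewrite /= !inordK; last first.
  - by rewrite -cV cardE index_mem mem_enum memV.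
  - by rewrite -cV cardE index_mem mem_enum memV.
  by move/(index_inj (val a)) => eq; apply: val_inj; apply: eq; rewrite mem_enum memV.
exists [ffun a => f a]; apply/and3P; split.
- by apply/injectiveP => a c; rewrite !ffunE => /injf.
- rewrite card_sum !card_ord card_sig.
  have -> : #|[pred v | v \in incident_vertices F]| = #|W :|: V|.
    by apply: eq_card => v; rewrite -incF.
  by rewrite cardsU disjoint_setI0 // cards0 subn0 cW cV.
apply/forallP => a; apply/forallP => c; apply/eqP; rewrite !ffunE.
(* Neither graph has loops; distinct vertices span an edge of the complete graph, whose membership
   in [F] can be read off from [W]. *)
have [->|nac] := eqVneq a c.
  transitivity false.
    by case: (f c) => i; rewrite /join_graph /complete_graph /= ?eqxx.
  by apply/esym/negbTE/negP => /edge_subgraph_neq; rewrite eqxx.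
have nfac : f a != f c by rewrite (inj_eq injf).
have [e ee] := @edge_exists (val a) (val c) nac.
rewrite (edge_subgraphE ee) [in RHS]eF.
rewrite (join_edgesE ee) ?memWV //; move: nfac; rewrite /f.
by case: ifP => aW; case: ifP => cW'.
Qed.

(** The edgeless graph on one vertex is also complete, so the star is a join with a single vertex in
    its complete part; that vertex is the centre. *)
Lemma star_copiesP t F :
  reflect (exists2 v, F \subset star v & #|F| = t.+1) (F \in star_copies n t.+1).
Proof.
rewrite inE (@eq_graph_iso _ _ _ _
  (join_graph (@complete_graph 1) (@edgeless_graph t.+1))); last first.
  by move=> [i|i] [j|j] //=; rewrite !ord1.
apply: (iffP (graph_iso_joinP _ _ _)) => [[W [V [/eqP/cards1P[v ->] cV]]]|[v sF cF]].
  rewrite disjoints1 => nvV ->; exists v.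
    by apply/subsetP => e; rewrite !inE => /andP[];
      rewrite disjoint_sym disjoints1 negbK.
  rewrite -cV -(card_fan nvV); congr #|pred_of_set _|; apply/setP => e.
  rewrite !inE disjoint_sym disjoints1 negbK; apply/andP/exists_inP => [[ve sub]|].
    have [w nwv ew] := edge_ofP ve; exists w; rewrite ?ew //.
    have : w \in v |: V by rewrite (subsetP sub) // ew set22.
    by rewrite !inE (negPf nwv).
  by move=> [w wV /eqP->]; rewrite set21 setUS ?sub1set.
pose N := [set w | (w != v) && [exists e in F, w \in val e]].
have nvN : v \notin N by rewrite inE eqxx.
have FE : F = fan v N.
  apply/setP => e; rewrite inE; apply/idP/exists_inP => [eF|[w]].
    have := subsetP sF e eF; rewrite inE => /edge_ofP[w nwv ew].
    exists w; rewrite ?ew // inE nwv; apply/exists_inP; exists e => //.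
    by rewrite ew set22.
  rewrite inE => /andP[nwv /exists_inP[d dF wd]] /eqP ee.
  (* Two edges containing both [v] and [w] coincide. *)
  suff -> : e = d by [].
  apply: val_inj; rewrite /= ee; apply/esym.
  apply: star_cap_val; first by rewrite eq_sym.
  by rewrite inE (subsetP sF) //= inE.
exists [set v], N; rewrite cards1 -cF FE card_fan // disjoints1; split=> //.
apply/setP => e; rewrite !inE disjoint_sym disjoints1 negbK.
apply/exists_inP/andP => [[w wN /eqP->]|[ve sub]].
  by rewrite set21 setUS ?sub1set.
have [w nwv ew] := edge_ofP ve; exists w; rewrite ?ew //.
have : w \in v |: N by rewrite (subsetP sub) // ew set22.
by rewrite inE in_set1 (negPf nwv).
Qed.

(** The two parts have [n] vertices in all, so the edgeless part is the complement of [W], and the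
    edges are exactly those meeting [W]. *)
Lemma is_K_joinP b F : b.+1 < n ->
  reflect (exists2 W : {set 'I_n}, #|W| = b.+1 & F = \bigcup_(w in W) star w)
    (is_K_join F b.+1).
Proof.
move=> ltbn; rewrite /is_K_join.
have starsE W : \bigcup_(w in W) star w = join_edges W (~: W).
  apply/setP => e; rewrite inE setUCr subsetT andbT.
  apply/bigcupP/pred0Pn => [[w wW]|[w /andP[we wW]]].
    by rewrite inE => we; exists w; rewrite /= we.
  by exists w; rewrite ?inE.
case nb: (n - b.+1) => [|m]; first by move: ltbn; rewrite -subn_gt0 nb.
apply: (iffP (graph_iso_joinP _ _ _)) => [[W [V [cW cV dWV ->]]]|[W cW ->]].
  exists W; rewrite // starsE; congr join_edges.
  apply/eqP; rewrite eqEcard cV cardsCs setCK cW card_ord nb leqnn andbT.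
  by rewrite -disjoints_subset disjoint_sym.
exists W, (~: W); rewrite starsE; split=> //.
  by rewrite cardsCs setCK cW card_ord.
by rewrite -setI_eq0 setICr.
Qed.

End Stars.

(** Independence is determined by the cyclic flats and their ranks. This allows any matroid meeting
    the definition to be replaced by an explicit one. *)
Lemma is_M_unique n t (M N : matroid (edge n)) : is_M t M -> is_M t N -> M = N.
Proof.
move=> [cfM rM0 rMT rMK] [cfN rN0 rNT rNK].
have cfE Z : cyclic_flat M Z <-> cyclic_flat N Z by rewrite cfM cfN.
have rE Z : cyclic_flat M Z -> rank M Z = rank N Z.
  case/cfM => [->|->|[b b_t Kb]]; first by rewrite rM0 rN0.
    by case: (etrans rMT (esym rNT)).
  by case: (etrans (rMK Z b b_t Kb) (esym (rNK Z b b_t Kb))).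
apply: matroid_eq; apply/setP => A.
apply/idP/idP => /indep_cyclic_flatP AZ; apply/indep_cyclic_flatP => Z cZ.
  by rewrite -rE; [apply: AZ|]; apply/cfE.
by rewrite rE //; apply: AZ; apply/cfE.
Qed.

(** * Sequences of stars certifying upper bounds on val *)

Section StarCover.
Variables n t : nat.
Implicit Types (v w x : 'I_n) (A F U X Z : {set edge n}).

(** A certificate that val of [U] is at most [r]: as the union of [S] lies in [U], the value of [S]
    at [U] is [#|U| - #|S|]. The additive form avoids subtraction. *)
Definition star_cover U (r : nat) :=
  exists S, [/\ proper_seq (star_copies n t.+1) S, union_seq S \subset U
              & #|U| <= r + size S].

Lemma star_cover_set A : star_cover A #|A|.
Proof.
exists [::]; rewrite addn0; split=> //; first exact: proper_seq_nil.
by rewrite /union_seq big_nil sub0set.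
Qed.

Lemma star_coverU U A r : star_cover U r -> star_cover (U :|: A) (r + #|A|).
Proof.
case=> S [propS sSU cU]; exists S; split=> //.
  exact: subset_trans sSU (subsetUl _ _).
by rewrite cardsU; lia.
Qed.

(** Once [t] edges at [v] are present, each missing edge at [v] completes a star with [t + 1] edges.
    It adds one element and one member to the sequence, so [r] does not change. *)
Lemma star_cover_star U r v :
  star_cover U r -> t <= #|U :&: star v| -> star_cover (U :|: star v) r.
Proof.
have [m] := ubnP #|star v :\: U|; elim: m => // m IH in U * => ltm cU ltt.
have [vU|[e /setDP[ve eU]]] := set_0Vmem (star v :\: U).
  by rewrite (setUidPl _) // -setD_eq0 vU.
have -> : U :|: star v = (e |: U) :|: star v.
  by rewrite -setUA [RHS](setUidPr _) // sub1set in_setU ve orbT.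
apply: IH.
- rewrite (cardsD1 e) in_setD eU ve ltnS add1n in ltm.
  apply: leq_ltn_trans ltm; rewrite subset_leq_card //.
  by apply/subsetP => d; rewrite !inE negb_or -!andbA => /and3P[-> -> ->].
- have [S [propS sSU cS]] := cU; have [B sB cB] := exists_subset_card ltt.
  (* The new star is not covered by the earlier ones, since they lie in [U] and [e] does not. *)
  exists (rcons S (e |: B)).
  have sBU : B \subset U by apply: subset_trans sB (subsetIl _ _).
  split; last by rewrite cardsU1 eU size_rcons addnS ltnS.
    apply/proper_seq_rcons; split=> // [|_].
      apply/star_copiesP; exists v.
        by rewrite subUset sub1set ve (subset_trans sB) ?subsetIr.
      by rewrite cardsU1 cB (contra (subsetP sBU e) eU).
    by apply: contra eU => /subsetP sub; rewrite (subsetP sSU) // sub ?setU11.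
  by rewrite union_seq_rcons subUset setUS // (subset_trans sSU) ?subsetUr.
- apply: leq_trans ltt _; apply: subset_leq_card.
  by apply: setSI; apply: subsetUr.
Qed.

Lemma star_cover_stars U r (s : seq 'I_n) :
  star_cover U r -> (forall v, t <= #|U :&: star v|) ->
  star_cover (U :|: \bigcup_(v <- s) star v) r.
Proof.
move=> cU ltt; elim: s => [|v s IH]; first by rewrite big_nil setU0.
rewrite big_cons setUCA setUC; apply: star_cover_star => //.
by apply: leq_trans (ltt v) _; apply: subset_leq_card; apply: setSI; apply: subsetUl.
Qed.

Lemma val_star_cover F Z r : star_cover Z r ->
  exists2 S, proper_seq (star_copies n t.+1) S
           & (val_seq F S <= (r + #|F :\: Z|)%N%:Z)%R.
Proof.
case=> S [propS sSZ cZ]; exists S => //; rewrite /val_seq.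
have := subset_leq_card (setUS F sSZ); rewrite [F :|: Z]setUC (card_setU_setD Z F); lia.
Qed.

Lemma rank_star_cover (N : matroid (edge n)) Z r :
  K1t_matroid t.+1 N -> star_cover Z r -> rank N Z <= r.
Proof.
move=> NK /(val_star_cover Z)[S propS le].
by have := rank_le_val Z NK propS; rewrite setDv cards0 in le; lia.
Qed.

End StarCover.

(** * The explicit matroid for [t = 4] *)

Section FourStars.
Variable n : nat.
Implicit Types (u v w z : 'I_n) (e x y : edge n) (A B F I U X Y Z : {set edge n}).

(* The cyclic flats of M_{4,n} with their ranks: K_b + \bar K_{n-b} is the union
   of b full stars. *)
Inductive cflat4 : {set edge n} -> nat -> Prop :=
| Cflat0 : cflat4 set0 0
| Cflat1 v : cflat4 (star v) 3
| Cflat2 u v : u != v -> cflat4 (star u :|: star v) 5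
| CflatT : cflat4 setT 6.

Definition indep4 : {set {set edge n}} :=
  [set A : {set edge n} | [&& #|A| <= 6, [forall v, #|A :&: star v| <= 3]
    & [forall u, forall v, (u != v) ==> (#|A :&: (star u :|: star v)| <= 5)]]].

Lemma indep4P A :
  reflect (forall Z r, cflat4 Z r -> #|A :&: Z| <= r) (A \in indep4).
Proof.
rewrite inE; apply: (iffP and3P) => [[le6 /forallP le3 /forallP le5] Z r|H].
  case=> [|v|u v nuv|]; rewrite ?setI0 ?cards0 ?setIT //.
  by move/forallP/(_ v)/implyP: (le5 u); apply.
split; first by have := H _ _ CflatT; rewrite setIT.
  by apply/forallP => v; apply: H; constructor.
by apply/forallP => u; apply/forallP => v; apply/implyP => nuv; apply: H; constructor.
Qed.

Lemma not_indep4P A : A \notin indep4 -> exists Z r, cflat4 Z r /\ r < #|A :&: Z|.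
Proof.
rewrite inE !negb_and -ltnNge => /or3P[lt6|/forallPn[v lt3]|/forallPn[u /forallPn[v]]].
- by exists setT, 6; rewrite setIT; split=> //; constructor.
- by exists (star v), 3; rewrite ltnNge; split=> //; constructor.
rewrite negb_imply => /andP[nuv lt5].
by exists (star u :|: star v), 5; rewrite ltnNge; split=> //; constructor.
Qed.

(** A constraint violated only after adding [x] must involve [x], and one element raises the
    intersection by at most one. *)
Lemma tight_cflat4 A x : A \in indep4 -> x |: A \notin indep4 ->
  exists Z r, [/\ cflat4 Z r, x \in Z & #|A :&: Z| = r].
Proof.
move=> /indep4P AI /not_indep4P[Z [r [cfZ ltr]]]; exists Z, r.
have le := AI Z r cfZ.
have xZ : x \in Z.
  apply: contraLR ltr => nxZ; rewrite -leqNgt; apply: leq_trans le.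
  apply: subset_leq_card; rewrite setIUl subUset subxx andbT.
  apply/subsetP => y; rewrite inE in_set1 => /andP[/eqP->]; by rewrite (negPf nxZ).
split=> //; apply/eqP; rewrite eqn_leq le -ltnS (leq_trans ltr) //.
rewrite setIUl; apply: leq_trans (leq_card_setU _ _) _.
by rewrite -add1n leq_add2r -(cards1 x) subset_leq_card ?subsetIl.
Qed.

(** The only possible edges of [A] at [w] are those joining [w] to [u] and to [v]. *)
Lemma two_stars_cap A u v w :
  A \subset star u :|: star v -> w != u -> w != v -> #|A :&: star w| <= 2.
Proof.
move=> sA nwu nwv.
have -> : 2 = #|star w :&: star u| + #|star w :&: star v| by rewrite !card_star_cap.
apply: leq_trans (leq_card_setU _ _); rewrite -setIUr setIC.
by apply: subset_leq_card; apply: setIS.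
Qed.

(** If [z] is [u] or [v], there are at most three edges at [z] and one further edge at [w];
    otherwise there are at most two edges at each of [w] and [z]. *)
Lemma two_stars_cap_two A u v w z : A \in indep4 ->
  A \subset star u :|: star v -> w != u -> w != v ->
  #|A :&: (star w :|: star z)| <= 4.
Proof.
move=> /indep4P AI sA nwu nwv.
have case_u a c : A \subset star a :|: star c -> w != c ->
    #|A :&: (star w :|: star a)| <= 4.
  move=> sA' nwc; apply: (@leq_trans #|(A :&: star a) :|: (star w :&: star c)|).
    apply: subset_leq_card; apply/subsetP => e; rewrite !inE => /andP[eA].
    rewrite eA /=; have := subsetP sA' e eA; rewrite !inE.
    by case: (a \in _) => //= -> /orP[->|].
  apply: leq_trans (leq_card_setU _ _) _.
  by rewrite card_star_cap // addn1 ltnS AI //; constructor.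
have [->|nzu] := eqVneq z u; first exact: (case_u u v).
have [->|nzv] := eqVneq z v; first by apply: (case_u v u) => //; rewrite setUC.
rewrite setIUr; apply: leq_trans (leq_card_setU _ _) _.
by apply: (@leq_add _ _ 2 2); apply: (two_stars_cap sA).
Qed.

(* This single statement yields both the exchange axiom and the rank formula. *)
Lemma cflat4_of_maximal A F : A \in indep4 ->
  (forall x, x \in F :\: A -> x |: A \notin indep4) ->
  exists Z r, cflat4 Z r /\ r + #|F :\: Z| <= #|A|.
Proof.
move=> AI maxA; have AP := indep4P _ AI.
have tight x : x \in F -> x \notin A ->
    exists Z r, [/\ cflat4 Z r, x \in Z & #|A :&: Z| = r].
  by move=> xF xA; apply: tight_cflat4 => //; apply: maxA; rewrite inE xA.
have [ge6|lt6] := leqP 6 #|A|.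
  by exists setT, 6; rewrite setDT cards0 addn0; split=> //; constructor.
(* Tight flats are tried from the largest down. A tight pair contains all of [A], which has fewer
   than six edges; then no flat through an edge outside the pair can be tight. *)
have [/existsP[u /existsP[v /andP[nuv /eqP t5]]]|no2] :=
    boolP [exists u, exists v, (u != v) && (#|A :&: (star u :|: star v)| == 5)].
  exists (star u :|: star v), 5; split; first by constructor.
  have sA : A \subset star u :|: star v.
    have /eqP {1}<- : A :&: (star u :|: star v) == A.
      by rewrite eqEcard subsetIl t5.
    exact: subsetIr.
  suff /eqP -> : F :\: (star u :|: star v) == set0.
    by rewrite cards0 -t5 addn0 subset_leq_card ?subsetIl.
  rewrite setD_eq0; apply/subsetP => x xF; apply: contraT => nxuv.
  have [Z [r [cfZ xZ cZ]]] := tight x xF (contra (subsetP sA x) nxuv).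
  have neq w : x \in star w -> w != u /\ w != v.
    move: nxuv; rewrite !inE negb_or => /andP[nu nv] xw.
    by split; [apply: contraNneq nu => <-|apply: contraNneq nv => <-].
  case: cfZ xZ cZ => [|w|w z _|]; rewrite ?setIT ?inE //.
  - move=> xw; have [|nwu nwv c3] := neq w; first by rewrite inE.
    by have := two_stars_cap sA nwu nwv; rewrite c3.
  - case/orP=> [xw|xz].
      have [|nwu nwv c5] := neq w; first by rewrite inE.
      by have := two_stars_cap_two z AI sA nwu nwv; rewrite c5.
    have [|nzu nzv c5] := neq z; first by rewrite inE.
    by have := two_stars_cap_two w AI sA nzu nzv; rewrite setUC c5.
  - by move=> _ c6; rewrite c6 in lt6.
have {}no2 u v : u != v -> #|A :&: (star u :|: star v)| <= 4.
  move=> nuv; have := AP _ _ (Cflat2 nuv); rewrite leq_eqVlt ltnS => /predU1P[c5|//].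
  by case/existsP: no2; exists u; apply/existsP; exists v; rewrite nuv c5.
(* With no tight pair, two distinct tight stars are impossible: they share at most one edge, so
   their union would contain at least [3 + 3 - 1 = 5] edges of [A]. *)
have [/existsP[u /eqP t3]|no1] := boolP [exists u, #|A :&: star u| == 3].
  exists (star u), 3; split; first by constructor.
  rewrite -t3 -(cardsID (star u) A) leq_add2l; apply: subset_leq_card.
  apply/subsetP => x /setDP[xF nxu]; rewrite inE nxu /=; apply: contraT => nxA.
  have [Z [r [cfZ xZ cZ]]] := tight x xF nxA.
  case: cfZ xZ cZ => [|w|w z nwz|]; rewrite ?setIT ?inE //.
  - move=> xw c3; have nuw : u != w by apply: contraNneq nxu => ->; rewrite inE.
    have := no2 _ _ nuw; rewrite setIUr cardsU t3 c3 -setIIr.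
    have := subset_leq_card (subsetIr A (star u :&: star w)).
    by rewrite card_star_cap //; lia.
  - by move=> _ c5; have := no2 _ _ nwz; rewrite c5.
  - by move=> _ c6; rewrite c6 in lt6.
(* No flat is left to block an extension, so [F] is contained in [A]. *)
exists set0, 0; split; first by constructor.
rewrite setD0; apply: subset_leq_card; apply/subsetP => x xF; apply: contraT => nxA.
have [Z [r [cfZ xZ cZ]]] := tight x xF nxA.
case: cfZ xZ cZ => [|w|w z nwz|]; rewrite ?setIT ?inE //.
- by move=> _ c3; case/existsP: no1; exists w; rewrite c3.
- by move=> _ c5; have := no2 _ _ nwz; rewrite c5.
- by move=> _ c6; rewrite c6 in lt6.
Qed.

Lemma indep4_card_le A F Z r :
  A \in indep4 -> A \subset F -> cflat4 Z r -> #|A| <= r + #|F :\: Z|.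
Proof.
move=> /indep4P AI sAF cfZ; rewrite -(cardsID Z A) leq_add ?AI //.
by apply: subset_leq_card; apply: setSD.
Qed.

Lemma indep4_matroid : matroid_axioms indep4.
Proof.
apply/and3P; split.
- by apply/indep4P => Z r _; rewrite set0I cards0.
- apply/forall_inP => A /indep4P AI; apply/forallP => B; apply/implyP => sBA.
  apply/indep4P => Z r /AI; apply: leq_trans.
  by apply: subset_leq_card; apply: setSI.
apply/forall_inP => A AI; apply/forall_inP => B BI; apply/implyP.
apply: contraLR => /exists_inPn maxA; rewrite -leqNgt.
(* Taking [F] to be [B], the flat bounds [#|B|] from above by [r + #|B :\: Z|], hence by [#|A|]. *)
have [Z [r [cfZ le]]] := cflat4_of_maximal AI maxA.
by apply: leq_trans le; apply: indep4_card_le.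
Qed.

Definition M4 : matroid (edge n) := Matroid indep4_matroid.

(** A basis of [F] is maximal in [F]. With [indep4_card_le], the rank of [F] is the minimum of
    [r + #|F :\: Z|] over the listed flats. *)
Lemma rank_M4_attained F : exists Z r, cflat4 Z r /\ r + #|F :\: Z| <= rank M4 F.
Proof.
have [A AI [sAF cA]] := basis_exists M4 F; rewrite -cA.
apply: cflat4_of_maximal => // x /setDP[xF xA]; apply/negP => xAI.
have : #|x |: A| <= rank M4 F.
  by apply: indep_le_rank => //; rewrite subUset sub1set xF.
by rewrite cardsU1 xA -cA ltnn.
Qed.

Lemma card_starD1 u w : u != w -> #|star u :\: star w| = n - 2.
Proof. by move=> nuw; rewrite cardsD card_star card_star_cap //; lia. Qed.

(** Only a lower bound, because [w] and [z] may coincide. *)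
Lemma card_starD2 u w z : u != w -> u != z ->
  n - 3 <= #|star u :\: (star w :|: star z)|.
Proof.
move=> nuw nuz; rewrite cardsD card_star setIUr.
have [+ _] := leq_card_setU (star u :&: star w) (star u :&: star z).
by rewrite !card_star_cap //; lia.
Qed.

Lemma card_two_stars u v : u != v -> #|star u :|: star v| = 2 * n - 3.
Proof. by move=> nuv; rewrite cardsU !card_star card_star_cap //; lia. Qed.

(** * Cyclic flats of the explicit matroid *)

Variable n_ge5 : 5 <= n.

Lemma fresh_vertex (W : {set 'I_n}) : #|W| < 5 -> exists v, v \notin W.
Proof.
move=> lt; have : 0 < #|~: W| by have := cardsC W; rewrite card_ord; lia.
by case/card_gt0P => v; rewrite inE; exists v.
Qed.

(** The minimum in the rank formula at [Z] is attained by [Z] alone, which yields both its rank and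
    its flatness. The bound on [n] enters here: a star against the empty set needs [3 < n - 1]. *)
Lemma cflat4_lt Z r Z' r' : cflat4 Z r -> cflat4 Z' r' ->
  (Z = Z' /\ r = r') \/ r < r' + #|Z :\: Z'|.
Proof.
have sub1 u w Y : u != w -> star u \subset Y -> n - 2 <= #|Y :\: star w|.
  by move=> nuw sY; rewrite -(card_starD1 nuw) subset_leq_card // setSD.
have sub2 u w z Y : u != w -> u != z -> star u \subset Y ->
    n - 3 <= #|Y :\: (star w :|: star z)|.
  move=> nuw nuz sY; apply: leq_trans (card_starD2 nuw nuz) _.
  by rewrite subset_leq_card // setSD.
case=> [|u|u v nuv|]; case=> [|w|w z nwz|]; try by [left|right; rewrite ?ltn_addr].
- by right; rewrite setD0 card_star; lia.
- have [->|nuw] := eqVneq u w; first by left.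
  by right; rewrite card_starD1 //; lia.
- by right; rewrite setD0 card_two_stars //; lia.
- right; have [eu|nuw] := eqVneq u w.
    have := @sub1 v w (star u :|: star v).
    by rewrite -eu eq_sym subsetUr => /(_ nuv isT); lia.
  by have := sub1 u w (star u :|: star v) nuw (subsetUl _ _); lia.
(* Unless the two pairs coincide, a vertex of the first outside the second supplies at least [n - 3]
   further edges. *)
- have [uwz|] := boolP (u \in [set w; z]); last first.
    rewrite !inE negb_or => /andP[nuw nuz]; right.
    by have := sub2 u w z (star u :|: star v) nuw nuz (subsetUl _ _); lia.
  have [vwz|] := boolP (v \in [set w; z]); last first.
    rewrite !inE negb_or => /andP[nvw nvz]; right.
    by have := sub2 v w z (star u :|: star v) nvw nvz (subsetUr _ _); lia.
  left; split=> //; move: uwz vwz nuv; rewrite !inE.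
  by case/orP=> /eqP-> /orP[]/eqP->; rewrite ?eqxx // setUC.
(* Two stars already contain [2 * n - 3], hence at least seven, edges. *)
- have [u _] := @fresh_vertex set0 (ltac:(by rewrite cards0)).
  have [v nv] := @fresh_vertex [set u] (ltac:(by rewrite cards1)).
  right; rewrite setD0; apply: (@leq_trans #|star u :|: star v|).
    by rewrite card_two_stars 1?eq_sym -?in_set1 //; lia.
  by rewrite subset_leq_card ?subsetT.
- have [u] := @fresh_vertex [set w] (ltac:(by rewrite cards1)); rewrite inE => nuw.
  have [v] := @fresh_vertex [set w; u] (ltac:(by rewrite cards2; case: (_ != _))).
  rewrite !inE negb_or => /andP[nvw nvu]; right.
  have := sub1 u w (star u) nuw (subxx _).
  have := sub2 v w u (star v) nvw nvu (subxx _).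
  (* Edges avoiding [w] are counted at [u] first, then at [v] but not at [u]. *)
  have : #|star u :\: star w| + #|star v :\: (star w :|: star u)| <= #|setT :\: star w|.
    rewrite -(cardsID (star u) (setT :\: star w)) leq_add // subset_leq_card //.
      by apply/subsetP => e; rewrite !inE => /andP[-> ->].
    by apply/subsetP => e; rewrite !inE negb_or => /andP[/andP[-> ->]].
  lia.
- have [u] := @fresh_vertex [set w; z] (ltac:(by rewrite cards2; case: (_ != _))).
  rewrite !inE negb_or => /andP[nuw nuz]; right.
  by have := sub2 u w z setT nuw nuz (subsetT _); lia.
Qed.

Lemma rank_M4_cflat4 Z r : cflat4 Z r -> rank M4 Z = r.
Proof.
move=> cfZ; apply/eqP; rewrite eqn_leq; apply/andP; split.
  apply/rankP => I II sIZ.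
  by have := indep4_card_le II sIZ cfZ; rewrite setDv cards0 addn0.
have [Z' [r' [cfZ' le]]] := rank_M4_attained Z; apply: leq_trans le.
by case: (cflat4_lt cfZ cfZ') => [[_ ->]|/ltnW //]; apply: leq_addr.
Qed.

(** Consider a flat attaining the rank of [x |: Z]. If it is [Z], then [x] contributes one; any
    other flat already gives more than [r] on [Z]. *)
Lemma flat_M4_cflat4 Z r : cflat4 Z r -> flat M4 Z.
Proof.
move=> cfZ x xZ; rewrite (rank_M4_cflat4 cfZ).
have [Z' [r' [cfZ' le]]] := rank_M4_attained (x |: Z); apply: leq_trans le.
case: (cflat4_lt cfZ cfZ') => [[<- <-]|].
  rewrite -[ltnLHS]addn0 ltn_add2l card_gt0.
  by apply/set0Pn; exists x; rewrite !inE xZ eqxx.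
move/leq_trans; apply; rewrite leq_add2l; apply: subset_leq_card.
by apply: setSD; apply: subsetUr.
Qed.

Lemma indep4_card_le3 A : #|A| <= 3 -> A \in indep4.
Proof.
move=> le3; apply/indep4P => Z r.
have : #|A :&: Z| <= 3 by apply: leq_trans le3; rewrite subset_leq_card ?subsetIl.
move=> + cfZ; case: cfZ => //; last 2 first.
- by move=> u v _ /leq_trans; apply.
- by move/leq_trans; apply.
by rewrite setI0 cards0.
Qed.

Lemma K14_matroid_M4 : K1t_matroid 4 M4.
Proof.
move=> C /star_copiesP[v sC cC]; apply/circuitP; split.
  apply/negP => /indep4P/(_ _ _ (Cflat1 v)).
  by rewrite (setIidPl sC) cC.
move=> e eC; apply: indep4_card_le3.
by move: cC; rewrite (cardsD1 e) eC add1n => -[->].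
Qed.

(** Every edge of [Z] lies in a full star inside [Z], and three further edges of that star complete
    a circuit. *)
Lemma cyclic_M4_cflat4 Z r : cflat4 Z r -> cyclic M4 Z.
Proof.
move=> cfZ; apply/cyclic_coverP => e eZ.
have [v ve sZ] : exists2 v, e \in star v & star v \subset Z.
  case: cfZ eZ => [|v|u v _|]; rewrite ?inE //.
  - by exists v; rewrite ?inE.
  - by case/orP; [exists u|exists v]; rewrite ?inE ?subsetUl ?subsetUr.
  - move=> _; have /cards2P[v [w [_ ee]]] := valP e.
    by exists v; rewrite ?subsetT // inE ee set21.
have [|B sB cB] := @exists_subset_card _ (star v :\ e) 3.
  by have := cardsD1 e (star v); rewrite ve card_star; lia.
move: sB; rewrite subsetD1 => /andP[sB eB].
have sC : e |: B \subset star v by rewrite subUset sub1set ve.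
exists (e |: B); split; rewrite ?setU11 ?(subset_trans sC) //.
apply: K14_matroid_M4; apply/star_copiesP; exists v => //.
by rewrite cardsU1 eB cB.
Qed.

(** For a cyclic flat [F], the listed flat attaining its rank must be [F] itself, by
    [cyclic_flat_eq]. *)
Lemma cyclic_flat_M4P F : cyclic_flat M4 F <-> exists r, cflat4 F r.
Proof.
split=> [cfF|[r cfF]]; last first.
  by split; [apply: flat_M4_cflat4 cfF|apply: cyclic_M4_cflat4 cfF].
have [Z [r [cfZ le]]] := rank_M4_attained F.
by exists r; rewrite (cyclic_flat_eq cfF (Z := Z)) // (rank_M4_cflat4 cfZ).
Qed.

Lemma is_K_join1P F : reflect (exists v, F = star v) (is_K_join F 1).
Proof.
apply: (iffP (is_K_joinP _ _)) => [|[W /eqP/cards1P[v ->] ->]|[v ->]]; first lia.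
  by exists v; rewrite big_set1.
by exists [set v]; rewrite ?cards1 // big_set1.
Qed.

Lemma is_K_join2P F :
  reflect (exists u v, u != v /\ F = star u :|: star v) (is_K_join F 2).
Proof.
apply: (iffP (is_K_joinP _ _)) => [|[W /eqP/cards2P[u [v [nuv ->]]] ->]|]; first lia.
  by exists u, v; rewrite bigcup_setU !big_set1.
move=> [u [v [nuv ->]]].
by exists [set u; v]; rewrite ?cards2 ?nuv // bigcup_setU !big_set1.
Qed.

Lemma is_M4 : is_M 4 M4.
Proof.
(* Here [tau 4 = 3], and [rank_value 4] takes the values 3, 5, 6 at 1, 2, 3. *)
have tau4 b : 1 <= b <= (tau 4).-1 -> b = 1 \/ b = 2.
  by rewrite /tau; case: b => [|[|[|b]]] //; [left|right].
split.
- move=> F; rewrite cyclic_flat_M4P; split=> [[r]|].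
    case=> [|v|u v nuv|]; [exact: Or31|apply: Or33|apply: Or33|exact: Or32].
      by exists 1 => //; apply/is_K_join1P; exists v.
    by exists 2 => //; apply/is_K_join2P; exists u, v.
  case=> [->|->|[b /tau4[]-> KF]].
  + by exists 0; constructor.
  + by exists 6; constructor.
  + by have /is_K_join1P[v ->] := KF; exists 3; constructor.
  + by have /is_K_join2P[u [v [nuv ->]]] := KF; exists 5; constructor.
- exact: rank0.
- by rewrite (rank_M4_cflat4 CflatT).
move=> F b /tau4[]->.
  by case/is_K_join1P=> v ->; rewrite (rank_M4_cflat4 (Cflat1 v)).
by case/is_K_join2P=> u [v [nuv ->]]; rewrite (rank_M4_cflat4 (Cflat2 nuv)).
Qed.

(** * Maximality and the rank function *)

(** Only [3 + 2 + 1] edges need to be paid for: three at a first vertex, two at a second, whose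
    third edge goes to the first, and one at a third vertex. Every other vertex then has three edges
    to these, so its star comes for free. *)
Lemma star_cover_cflat4 Z r : cflat4 Z r -> star_cover 3 Z r.
Proof.
have cover1 v : star_cover 3 (star v) 3.
  have [|B sB cB] := @exists_subset_card _ (star v) 3; first by rewrite card_star; lia.
  have -> : star v = B :|: star v by rewrite (setUidPr sB).
  apply: star_cover_star; last by rewrite (setIidPl sB) cB.
  by rewrite -cB; apply: star_cover_set.
have cover2 u v : u != v -> star_cover 3 (star u :|: star v) 5.
  rewrite eq_sym => nvu.
  have [|B] := @exists_subset_card _ (star v :\: star u) 2.
    by rewrite card_starD1 //; lia.
  rewrite subsetD => /andP[sB dB] cB.
  have -> : star u :|: star v = (star u :|: B) :|: star v.
    by rewrite -setUA (setUidPr sB).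
  apply: star_cover_star.
    by have := star_coverU B (cover1 u); rewrite cB.
  have <- : #|(star v :&: star u) :|: B| = 3.
    rewrite cardsU card_star_cap // cB disjoint_setI0 ?cards0 //.
    by rewrite disjoint_sym (disjointWr _ dB) ?subsetIr.
  by apply: subset_leq_card; rewrite setIUl setIC (setIidPl sB).
case=> [|v|u v nuv|] //; first by rewrite -(cards0 (edge n)); apply: star_cover_set.
  exact: cover2.
have [u _] := @fresh_vertex set0 (ltac:(by rewrite cards0)).
have [v] := @fresh_vertex [set u] (ltac:(by rewrite cards1)).
rewrite inE eq_sym => nuv.
have [w] := @fresh_vertex [set u; v] (ltac:(by rewrite cards2; case: (_ != _))).
move=> wuv; have := wuv; rewrite !inE negb_or => /andP[nwu nwv].
have [e /setDP[we nuve]] : exists e, e \in star w :\: (star u :|: star v).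
  by apply/set0Pn; rewrite -card_gt0; have := card_starD2 nwu nwv; lia.
pose U := ((star u :|: star v) :|: [set e]) :|: star w.
have cU : star_cover 3 U 6.
  apply: star_cover_star.
    by have := star_coverU [set e] (cover2 u v nuv); rewrite cards1.
  (* The two edges from [w] to [u] and [v] are present; with [e] they make the three required at
     [w]. *)
  have le2 : 2 <= #|(star u :|: star v) :&: star w|.
    have -> : 2 = #|fan w [set u; v]| by rewrite card_fan // cards2 nuv.
    apply: subset_leq_card; rewrite subsetI fan_sub_star andbT.
    by apply/subsetP => d; rewrite !inE => /exists_inP[x] /set2P[]-> /eqP->;
      rewrite set22 ?orbT.
  rewrite [in X in _ <= X]setUC setIUl (setIidPl _) ?sub1set // cardsU1.
  by rewrite inE (negPf nuve).
have sU (x : 'I_n) : x \in [set u; v; w] -> star x \subset U.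
  rewrite !inE -orbA => /or3P[]/eqP->; rewrite /U ?subsetUr //.
    by rewrite -!setUA subsetUl.
  by rewrite -!setUA setUCA subsetUl.
have -> : setT = U :|: \bigcup_(x <- enum 'I_n) star x.
  apply/esym/eqP; rewrite eqEsubset subsetT; apply/subsetP => d _.
  have /cards2P[x [y [_ dd]]] := valP d; rewrite inE; apply/orP; right.
  rewrite big_enum /=; apply/bigcupP; exists x => //.
  by rewrite inE dd set21.
apply: star_cover_stars => // x.
have [/sU sxU|nx] := boolP (x \in [set u; v; w]).
  by rewrite (setIidPr sxU) card_star; lia.
(* The edges from [x] to the three chosen vertices lie in their full stars. *)
have -> : 3 = #|fan x [set u; v; w]|.
  by rewrite card_fan // setUC cardsU1 wuv cards2 nuv.
apply: subset_leq_card; rewrite subsetI fan_sub_star andbT.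
apply/subsetP => d; rewrite inE => /exists_inP[y yuvw /eqP dd].
by rewrite (subsetP (sU y yuvw)) // inE dd set22.
Qed.

Lemma weak_le_M4 (N : matroid (edge n)) : K1t_matroid 4 N -> weak_le N M4.
Proof.
move=> NK; apply/subsetP => A AN; apply/indep4P => Z r /star_cover_cflat4 cZ.
apply: leq_trans (rank_star_cover NK cZ).
apply: indep_le_rank (subsetIr _ _).
by apply: indepS AN; apply: subsetIl.
Qed.

Lemma unique_maximal_M4 : unique_maximal_in (@K1t_matroid n 4) M4.
Proof.
move=> N; split=> [[NK maxN]|->].
  by rewrite (maxN M4 K14_matroid_M4) //; apply: weak_le_M4.
split=> [|N' N'K le]; first exact: K14_matroid_M4.
by apply: matroid_eq; apply/eqP; rewrite eqEsubset le weak_le_M4.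
Qed.

(** The certificate of a flat attaining the rank has value at most the rank; the general lower bound
    forces equality. *)
Lemma is_val_M4 F : is_val (star_copies n 4) F (Posz (rank M4 F)).
Proof.
have lower S : proper_seq (star_copies n 4) S -> (Posz (rank M4 F) <= val_seq F S)%R.
  by apply: rank_le_val; apply: K14_matroid_M4.
split=> //; have [Z [r [cfZ le]]] := rank_M4_attained F.
have [S propS leS] := val_star_cover F (star_cover_cflat4 cfZ).
by exists S => //; have := lower S propS; lia.
Qed.

End FourStars.

Theorem theoremA11 (n : nat) (hn : 5 <= n) :
  (exists M : matroid (edge n), is_M 4 M) /\
  (forall M : matroid (edge n), is_M 4 M ->
     unique_maximal_in (@K1t_matroid n 4) M /\
     (forall F : {set edge n}, is_val (star_copies n 4) F (Posz (rank M F)))).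
Proof.
split=> [|M MM]; first by exists (M4 n); apply: is_M4.
rewrite (is_M_unique MM (is_M4 hn)); split; first exact: unique_maximal_M4.
exact: is_val_M4.
Qed.
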